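(* Let $\lambda>0$. Then $(\mathfrak h_3\oplus\mathbb R,S_\lambda^-,J)$ is a first and second kind algebraic Ricci soliton with respect to $\nabla^0$, with $c=\lambda$: the linear map $D$ represented in the basis $\{v_1,v_2,v_3,v_4\}$ by $\operatorname{diag}\{-\frac\lambda2,-\frac\lambda2,-\lambda,-\lambda\}$ is a derivation of $\mathfrak h_3\oplus\mathbb R$, and $\operatorname{Ric}^0=\lambda\operatorname{Id}+D$ and $\widetilde{\operatorname{Ric}}^0=\lambda\operatorname{Id}+D$.
   Context: $\mathfrak h_3\oplus\mathbb R$ is the real Lie algebra with basis $e_1,e_2,e_3,e_4$ and only non-zero bracket (up to skew-symmetry) $[e_1,e_2]=e_3$. For $\lambda>0$, $S_\lambda^-$ is the Lorentzian inner product $\langle\cdot,\cdot\rangle$ whose matrix in $(e_1,e_2,e_3,e_4)$ is $\operatorname{diag}(1,1,-\lambda,1)$. Fix the basis $v_1=e_1$, $v_2=e_2$, $v_3=e_4$, $v_4=\frac1{\sqrt\lambda}e_3$, which is orthonormal: $\langle v_i,v_j\rangle=0$ for $i\ne j$, $\langle v_i,v_i\rangle=1$ for $i=1,2,3$, $\langle v_4,v_4\rangle=-1$. The product structure $J$ is the linear map with $Jv_i=v_i$ for $i=1,2,3$ and $Jv_4=-v_4$. Write $\mathfrak g$ for the Lie algebra. The Levi-Civita connection is the bilinear map $\nabla:\mathfrak g\times\mathfrak g\to\mathfrak g$ with $2\langle\nabla_uv,w\rangle=\langle[u,v],w\rangle+\langle[w,u],v\rangle+\langle[w,v],u\rangle$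 for all $u,v,w$. Put $(\nabla_uJ)v=\nabla_u(Jv)-J(\nabla_uv)$. The canonical connection is $\nabla^0_uv=\nabla_uv-\frac12(\nabla_uJ)Jv$. Its curvature is $R^0_{uv}w=\nabla^0_{[u,v]}w-\nabla^0_u\nabla^0_vw+\nabla^0_v\nabla^0_uw$, its Ricci operator is $\operatorname{Ric}^0(u)=\sum_{k=1}^4\langle v_k,v_k\rangle R^0_{v_ku}v_k$, and $\rho^0(u,v)=\langle\operatorname{Ric}^0(u),v\rangle$. Put $\widetilde\rho^0(u,v)=\frac12(\rho^0(u,v)+\rho^0(v,u))$ and define $\widetilde{\operatorname{Ric}}^0$ by $\langle\widetilde{\operatorname{Ric}}^0(u),v\rangle=\widetilde\rho^0(u,v)$. A derivation of $\mathfrak g$ is a linear map $D:\mathfrak g\to\mathfrak g$ with $[D(u),v]+[u,D(v)]=D[u,v]$ for all $u,v\in\mathfrak g$. First (resp. second) kind algebraic Ricci soliton with respect to $\nabla^0$ means $\operatorname{Ric}^0=c\operatorname{Id}+D$ (resp. $\widetilde{\operatorname{Ric}}^0=c\operatorname{Id}+D$) for some $c\in\mathbb R$ and some derivation $D$. *)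

(* Defs.v *)
From HB Require Import structures.
From mathcomp Require Import all_boot all_order all_algebra.
From mathcomp Require Import reals ring.

Set Implicit Arguments.
Unset Strict Implicit.
Unset Printing Implicit Defensive.

Import Order.TTheory GRing.Theory Num.Theory.
Local Open Scope ring_scope.

Definition is_lie_bracket (K : fieldType) (V : lmodType K)
    (br : V -> V -> V) : Prop :=
  [/\ bilinear_for *:%R *:%R br,
      forall u, br u u = 0
    & forall u v w, br u (br v w) + br v (br w u) + br w (br u v) = 0].

Definition is_derivation (K : fieldType) (V : vectType K)
    (br : V -> V -> V) (D : 'End(V)) : Prop :=
  forall u v, br (D u) v + br u (D v) = D (br u v).

(* Koszul formula for left-invariant vector fields. *)
Definition is_levi_civita (K : fieldType) (V : lmodType K)
    (br : V -> V -> V) (ip : V -> V -> K) (nabla : V -> V -> V) : Prop :=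
  forall u v w,
    2 * ip (nabla u v) w = ip (br u v) w + ip (br w u) v + ip (br w v) u.

(* (nabla_u J) v *)
Definition nablaJ (K : fieldType) (V : lmodType K)
    (nabla : V -> V -> V) (J : V -> V) (u v : V) : V :=
  nabla u (J v) - J (nabla u v).

Definition canonical_connection (K : fieldType) (V : lmodType K)
    (nabla : V -> V -> V) (J : V -> V) (u v : V) : V :=
  nabla u v - 2^-1 *: nablaJ nabla J u (J v).

(* Sign convention: R_{uv} = nabla_[u,v] - [nabla_u, nabla_v]. *)
Definition curvature (K : fieldType) (V : lmodType K)
    (br nabla : V -> V -> V) (u v w : V) : V :=
  nabla (br u v) w - nabla u (nabla v w) + nabla v (nabla u w).

(* [e] is meant to be a pseudo-orthonormal basis for [ip]. *)
Definition ricci_operator (K : fieldType) (V : lmodType K)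
    (br : V -> V -> V) (ip : V -> V -> K) (nabla : V -> V -> V)
    (n : nat) (e : n.-tuple V) (u : V) : V :=
  \sum_(k < n) ip e`_k e`_k *: curvature br nabla e`_k u e`_k.

Definition ricci_tensor (K : fieldType) (V : lmodType K)
    (br : V -> V -> V) (ip : V -> V -> K) (nabla : V -> V -> V)
    (n : nat) (e : n.-tuple V) (u v : V) : K :=
  ip (ricci_operator br ip nabla e u) v.

Definition sym_ricci_tensor (K : fieldType) (V : lmodType K)
    (br : V -> V -> V) (ip : V -> V -> K) (nabla : V -> V -> V)
    (n : nat) (e : n.-tuple V) (u v : V) : K :=
  2^-1 * (ricci_tensor br ip nabla e u v + ricci_tensor br ip nabla e v u).

Definition is_sym_ricci_operator (K : fieldType) (V : lmodType K)
    (br : V -> V -> V) (ip : V -> V -> K) (nabla : V -> V -> V)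
    (n : nat) (e : n.-tuple V) (T : V -> V) : Prop :=
  forall u v, ip (T u) v = sym_ricci_tensor br ip nabla e u v.

Definition is_algebraic_soliton (K : fieldType) (V : vectType K)
    (br : V -> V -> V) (T : V -> V) : Prop :=
  exists (c : K) (D : 'End(V)),
    is_derivation br D /\ forall u, T u = c *: u + D u.

Definition first_kind_soliton (K : fieldType) (V : vectType K)
    (br : V -> V -> V) (ip : V -> V -> K) (nabla : V -> V -> V)
    (n : nat) (e : n.-tuple V) : Prop :=
  is_algebraic_soliton br (ricci_operator br ip nabla e).

(* For a nondegenerate [ip], as here, the operator [T] is unique. *)
Definition second_kind_soliton (K : fieldType) (V : vectType K)
    (br : V -> V -> V) (ip : V -> V -> K) (nabla : V -> V -> V)
    (n : nat) (e : n.-tuple V) : Prop :=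
  exists T : V -> V,
    is_sym_ricci_operator br ip nabla e T /\ is_algebraic_soliton br T.

Definition diag_fun (K : fieldType) (V : vectType K) (n : nat)
    (e : n.-tuple V) (d : n.-tuple K) (u : V) : V :=
  \sum_(i < n) (d`_i * coord e i u) *: e`_i.

Fact diag_fun_linear (K : fieldType) (V : vectType K) (n : nat)
    (e : n.-tuple V) (d : n.-tuple K) : linear (diag_fun e d).
Proof.
move=> a u v; rewrite /diag_fun scaler_sumr -big_split /=.
by apply: eq_bigr => i _; rewrite linearP /= scalerA -scalerDl mulrDr mulrCA.
Qed.

HB.instance Definition _ (K : fieldType) (V : vectType K) (n : nat)
    (e : n.-tuple V) (d : n.-tuple K) :=
  GRing.isLinear.Build K V V *:%R (diag_fun e d) (diag_fun_linear e d).

(* The endomorphism with matrix diag(d) in the basis [e]. *)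
Definition diag_end (K : fieldType) (V : vectType K) (n : nat)
    (e : n.-tuple V) (d : n.-tuple K) : 'End(V) :=
  linfun (diag_fun e d).

Lemma diag_endE (K : fieldType) (V : vectType K) (n : nat)
    (e : n.-tuple V) (d : n.-tuple K) (i : 'I_n) :
  basis_of fullv e -> diag_end e d e`_i = d`_i *: e`_i.
Proof.
move=> be; rewrite /diag_end lfunE /= /diag_fun.
rewrite (bigD1 i) //= coord_free ?(basis_free be) // eqxx mulr1.
rewrite big1 ?addr0 // => j ji.
by rewrite coord_free ?(basis_free be) // eq_sym (negPf ji) mulr0 scale0r.
Qed.

(* The coordinates on 'rV_4 are those in the basis (e_1, e_2, e_3, e_4), which
   is indexed from 0 in Rocq: [h3R_e i] is e_(i+1). *)
Definition h3R_e (R : realType) (i : 'I_4) : 'rV[R]_4 := delta_mx 0 i.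

Definition h3R_bracket (R : realType) (u v : 'rV[R]_4) : 'rV[R]_4 :=
  (u 0 0 * v 0 1 - u 0 1 * v 0 0) *: h3R_e R 2.

Definition S_minus (R : realType) (lambda : R) (u v : 'rV[R]_4) : R :=
  (u *m diag_mx (\row_i [:: 1; 1; - lambda; 1]`_i) *m v^T) 0 0.

Definition h3R_v (R : realType) (lambda : R) : 4.-tuple 'rV[R]_4 :=
  [tuple h3R_e R 0; h3R_e R 1; h3R_e R 3;
         (Num.sqrt lambda)^-1 *: h3R_e R 2].

Definition h3R_J (R : realType) (lambda : R) : 'End('rV[R]_4) :=
  diag_end (h3R_v lambda) [tuple 1; 1; 1; -1].

Lemma row4P (R : realType) (u v : 'rV[R]_4) :
  u 0 0 = v 0 0 -> u 0 1 = v 0 1 -> u 0 2 = v 0 2 -> u 0 3 = v 0 3 -> u = v.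
Proof.
move=> h0 h1 h2 h3; apply/rowP => -[[|[|[|[|//]]]] i4].
- by rewrite (_ : Ordinal i4 = 0) //; apply/val_inj.
- by rewrite (_ : Ordinal i4 = 1) //; apply/val_inj.
- by rewrite (_ : Ordinal i4 = 2) //; apply/val_inj.
- by rewrite (_ : Ordinal i4 = 3) //; apply/val_inj.
Qed.

Lemma sum4E (V : zmodType) (f : 'I_4 -> V) :
  \sum_i f i = f 0 + f 1 + f 2 + f 3.
Proof.
rewrite !big_ord_recl big_ord0 addr0 !addrA.
by congr (f _ + f _ + f _ + f _); apply/val_inj.
Qed.

Lemma h3R_bracket_lie (R : realType) : is_lie_bracket (@h3R_bracket R).
Proof.
split.
- by split=> w a u v; rewrite /h3R_bracket; apply: row4P; rewrite !mxE /=; ring.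
- by move=> u; rewrite /h3R_bracket mulrC subrr scale0r.
- by move=> u v w; apply: row4P; rewrite !mxE /=; ring.
Qed.

Lemma S_minusE (R : realType) (lambda : R) (u v : 'rV[R]_4) :
  S_minus lambda u v =
    u 0 0 * v 0 0 + u 0 1 * v 0 1 - lambda * u 0 2 * v 0 2 + u 0 3 * v 0 3.
Proof. by rewrite /S_minus mul_mx_diag !mxE sum4E !mxE /=; ring. Qed.

Lemma h3R_v_orthonormal (R : realType) (lambda : R) (i j : 'I_4) :
  0 < lambda ->
  S_minus lambda (h3R_v lambda)`_i (h3R_v lambda)`_j =
    if i == j then [:: 1; 1; 1; -1]`_i else 0.
Proof.
move=> l0; have s0 : Num.sqrt lambda != 0 by rewrite gt_eqF // sqrtr_gt0.
have sl : Num.sqrt lambda ^- 2 * lambda = 1.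
  by rewrite sqr_sqrtr ?ltW // mulVf // gt_eqF.
rewrite S_minusE.
case: i j => -[|[|[|[|//]]]] i4 [[|[|[|[|//]]]] j4] /=;
  rewrite !mxE /=; try ring.
by move: sl; rewrite -exprVn => sl; rewrite -[X in _ = - X]sl; ring.
Qed.

Lemma h3R_v_basis (R : realType) (lambda : R) :
  0 < lambda -> basis_of fullv (h3R_v lambda).
Proof.
move=> l0; rewrite basisEfree subvf dimvf /dim /= mul1n leqnn !andbT.
apply/freeP => k k0 i.
have := congr1 (S_minus lambda ^~ (h3R_v lambda)`_i) k0.
have -> : S_minus lambda (\sum_(j < 4) k j *: (h3R_v lambda)`_j)
            (h3R_v lambda)`_i = k i * [:: 1; 1; 1; -1]`_i.
  rewrite /S_minus !mulmx_suml summxE (bigD1 i) //= big1 ?addr0.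
    rewrite -!scalemxAl mxE.
    by have := h3R_v_orthonormal i i l0; rewrite /S_minus eqxx => ->.
  move=> j ji; rewrite -!scalemxAl mxE.
  by have := h3R_v_orthonormal j i l0; rewrite /S_minus (negPf ji) => ->;
     rewrite mulr0.
rewrite S_minusE !mxE !(mul0r, mulr0, subr0, addr0).
by case: i => -[|[|[|[|//]]]] i4 /= /eqP;
   rewrite ?mulr1 ?mulrN1 ?oppr_eq0 => /eqP.
Qed.

Lemma h3R_levi_civita_exists (R : realType) (lambda : R) :
  0 < lambda ->
  exists nabla : {bilinear 'rV[R]_4 -> 'rV[R]_4 -> 'rV[R]_4},
    is_levi_civita (@h3R_bracket R) (S_minus lambda) nabla.
Proof.
move=> l0.
pose f (u v : 'rV[R]_4) : 'rV[R]_4 := \row_i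
  [:: - (lambda / 2) * (u 0 1 * v 0 2 + u 0 2 * v 0 1);
      lambda / 2 * (u 0 0 * v 0 2 + u 0 2 * v 0 0);
      2^-1 * (u 0 0 * v 0 1 - u 0 1 * v 0 0); 0]`_i.
have fB : bilinear_for *:%R *:%R f.
  by split=> w a u v; apply: row4P; rewrite !mxE /=; ring.
pose fM := bilinear_isBilinear.Build R _ _ _ *:%R *:%R f fB.
exists (HB.pack f fM : {bilinear 'rV[R]_4 -> 'rV[R]_4 -> 'rV[R]_4}).
by move=> u v w; rewrite !S_minusE !mxE /=; field.
Qed.

Lemma S_minus_riesz (R : realType) (lambda : R) (f : 'rV[R]_4 -> R) :
  0 < lambda -> scalar f ->
  exists! w : 'rV[R]_4, forall v, S_minus lambda w v = f v.
Proof.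
move=> l0 fl; have ln : lambda != 0 by rewrite gt_eqF.
have fS : forall a u, f (a *: u) = a * f u.
  have f0 : f 0 = 0.
    by have := fl (-1) 0 0; rewrite scaler0 addr0 mulN1r addNr.
  by move=> a u; have := fl a u 0; rewrite f0 !addr0.
have fD u v : f (u + v) = f u + f v.
  by have := fl 1 u v; rewrite scale1r mul1r.
pose e := h3R_e R.
exists (\row_i [:: f (e 0); f (e 1); - lambda^-1 * f (e 2); f (e 3)]`_i).
split=> [v|w hw].
  rewrite S_minusE !mxE /= [in RHS](row_sum_delta v) sum4E !fD !fS.
  by rewrite -!/(e _); field.
by apply: row4P; rewrite !mxE /= -hw S_minusE !mxE /=; field.
Qed.

(* Main.v *)
Require Import Defs.
From HB Require Import structures.
From mathcomp Require Import all_boot all_order all_algebra.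
From mathcomp Require Import reals ring.

Set Implicit Arguments.
Unset Strict Implicit.
Unset Printing Implicit Defensive.

Import Order.TTheory GRing.Theory Num.Theory.
Local Open Scope ring_scope.

(* The connection nabla^0 is the part of nabla commuting with J. Only the
   e_3-component of u survives in nabla^0_u = u_3 A, where A is the
   rotation generator e_1 |-> (lambda/2) e_2, e_2 |-> -(lambda/2) e_1. These
   operators all commute, so R^0_{uv} = nabla^0_{[u,v]} = (u_1 v_2 - u_2 v_1) A,
   and Ric^0 = diag(lambda/2, lambda/2, 0, 0), which is already self-adjoint. *)

(** The last two entries of [d] trade places, since v_3 = e_4 while v_4 is a multiple of e_3. *)
Lemma h3R_diag_endE (R : realType) (lambda : R) (d : 4.-tuple R)
    (u : 'rV[R]_4) :
  0 < lambda ->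
  diag_end (h3R_v lambda) d u =
    \row_i [:: d`_0 * u 0 0; d`_1 * u 0 1; d`_3 * u 0 2; d`_2 * u 0 3]`_i.
Proof.
move=> l0; have s0 : Num.sqrt lambda != 0 by rewrite gt_eqF // sqrtr_gt0.
have bv := h3R_v_basis l0.
(* Cancelling the nonzero factor 1/sqrt(lambda) in the eigenvalue equation at v_4 gives the one at
   e_3. *)
have := diag_endE d 3 bv; rewrite /= linearZ /= scalerA mulrC -scalerA.
move=> /(scalerI (invr_neq0 s0)) dE2.
rewrite {1}(row_sum_delta u) sum4E !linearD !linearZ /= -!/(h3R_e R _) dE2.
have := (diag_endE d 0 bv, diag_endE d 1 bv, diag_endE d 2 bv) => /= -[[-> ->] ->].
by apply: row4P; rewrite !mxE /=; ring.
Qed.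

Lemma S_minus_inj (R : realType) (lambda : R) (u v : 'rV[R]_4) :
  0 < lambda -> (forall w, S_minus lambda u w = S_minus lambda v w) -> u = v.
Proof.
move=> l0 uv.
have fl : scalar (S_minus lambda v).
  by move=> a x y; rewrite !S_minusE !mxE /=; ring.
have [w [_ wP]] := S_minus_riesz l0 fl.
by rewrite -(wP u) // -(wP v).
Qed.

Section LeviCivita.

Variables (R : realType) (lambda : R) (nabla : 'rV[R]_4 -> 'rV[R]_4 -> 'rV[R]_4).
Hypothesis lambda_gt0 : 0 < lambda.
Hypothesis nablaP : is_levi_civita (@h3R_bracket R) (S_minus lambda) nabla.

(** By nondegeneracy the Koszul formula has at most one solution, so it is enough to check this
    candidate. *)
Lemma h3R_levi_civitaE (u v : 'rV[R]_4) :
  nabla u v = \row_i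
  [:: - (lambda / 2) * (u 0 1 * v 0 2 + u 0 2 * v 0 1);
      lambda / 2 * (u 0 0 * v 0 2 + u 0 2 * v 0 0);
      2^-1 * (u 0 0 * v 0 1 - u 0 1 * v 0 0); 0]`_i.
Proof.
apply: (S_minus_inj lambda_gt0) => w.
apply: (@mulfI _ 2); first by rewrite pnatr_eq0.
by rewrite nablaP !S_minusE !mxE /=; field.
Qed.

(** As J^2 = 1, nabla^0_u = (nabla_u + J nabla_u J)/2, which erases the entries of nabla_u linking
    e_3 to the other basis vectors. *)
Lemma h3R_canonical_connectionE (u v : 'rV[R]_4) :
  canonical_connection nabla (h3R_J lambda) u v =
    \row_i [:: - (lambda / 2) * u 0 2 * v 0 1;
               lambda / 2 * u 0 2 * v 0 0; 0; 0]`_i.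
Proof.
rewrite /canonical_connection /nablaJ /h3R_J !h3R_diag_endE //.
by rewrite !h3R_levi_civitaE; apply: row4P; rewrite !mxE /=; field.
Qed.

Lemma h3R_canonical_curvatureE (u v w : 'rV[R]_4) :
  curvature (@h3R_bracket R) (canonical_connection nabla (h3R_J lambda)) u v w =
    (u 0 0 * v 0 1 - u 0 1 * v 0 0) *:
      \row_i [:: - (lambda / 2) * w 0 1; lambda / 2 * w 0 0; 0; 0]`_i.
Proof.
rewrite /curvature !h3R_canonical_connectionE.
by apply: row4P; rewrite !mxE /=; ring.
Qed.

(** Only v_1 and v_2 contribute: the factor of A in the curvature vanishes for v_3 and v_4. *)
Lemma h3R_canonical_ricciE (u : 'rV[R]_4) :
  ricci_operator (@h3R_bracket R) (S_minus lambda)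
    (canonical_connection nabla (h3R_J lambda)) (h3R_v lambda) u =
  \row_i [:: lambda / 2 * u 0 0; lambda / 2 * u 0 1; 0; 0]`_i.
Proof.
rewrite /ricci_operator sum4E !h3R_v_orthonormal // !h3R_canonical_curvatureE.
by apply: row4P; rewrite !mxE /=; ring.
Qed.

(** Ric^0 is diagonal in an orthogonal basis, so rho^0 is symmetric. *)
Lemma h3R_canonical_sym_ricci_operatorP :
  is_sym_ricci_operator (@h3R_bracket R) (S_minus lambda)
    (canonical_connection nabla (h3R_J lambda)) (h3R_v lambda)
    (ricci_operator (@h3R_bracket R) (S_minus lambda)
      (canonical_connection nabla (h3R_J lambda)) (h3R_v lambda)).
Proof.
move=> u v; rewrite /sym_ricci_tensor /ricci_tensor !h3R_canonical_ricciE.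
by rewrite !S_minusE !mxE /=; field.
Qed.

End LeviCivita.

Theorem theorem4p5 (R : realType) (lambda : R) (lambda_gt0 : 0 < lambda)
    (nabla : {bilinear 'rV[R]_4 -> 'rV[R]_4 -> 'rV[R]_4})
    (nabla_LC : is_levi_civita (@h3R_bracket R) (S_minus lambda) nabla) :
  let br := @h3R_bracket R in
  let ip := S_minus lambda in
  let v := h3R_v lambda in
  let nabla0 := canonical_connection nabla (h3R_J lambda) in
  let D := diag_end v
    [tuple - (lambda / 2); - (lambda / 2); - lambda; - lambda] in
  [/\ first_kind_soliton br ip nabla0 v,
      second_kind_soliton br ip nabla0 v,
      is_derivation br D,
      forall u, ricci_operator br ip nabla0 v u = lambda *: u + D u
    & forall symRic0 : 'rV[R]_4 -> 'rV[R]_4,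
        is_sym_ricci_operator br ip nabla0 v symRic0 ->
        forall u, symRic0 u = lambda *: u + D u].
Proof.
move=> br ip v nabla0 D.
(* Since e_3 = [e_1, e_2], its eigenvalue must be the sum of those of e_1 and e_2. *)
have DP : is_derivation br D.
  move=> x y; rewrite /D !h3R_diag_endE // /br /h3R_bracket.
  by apply: row4P; rewrite !mxE /=; field.
(* For Ric^0 - c Id the same rule reads -c = 2 (lambda/2 - c), whence c = lambda. *)
have ricP x : ricci_operator br ip nabla0 v x = lambda *: x + D x.
  rewrite h3R_canonical_ricciE // /D h3R_diag_endE //.
  by apply: row4P; rewrite !mxE /=; field.
have symP := h3R_canonical_sym_ricci_operatorP lambda_gt0 nabla_LC.
split=> //.
- by exists lambda, D.
- by exists (ricci_operator br ip nabla0 v); split=> //; exists lambda, D.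
(* [T] and Ric^0 represent the same symmetrized tensor, so they agree by nondegeneracy. *)
- move=> T TP x; rewrite -ricP; apply: (S_minus_inj lambda_gt0) => w.
  exact: etrans (TP x w) (esym (symP x w)).
Qed.
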